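(* Consider the causal adversarial multi-path network model described in the context, with $C$ links of unit capacity, additive jamming, no feedback and no secrecy requirement. For any adversary vector $\vec z=(z_{rw},z_{ro},z_{wo})$ with nonnegative integer entries and $z_{rw}+z_{ro}+z_{wo}\le C$, the capacity (maximum achievable reliable rate) is $$R^{add}_j(C,\vec z)=\begin{cases} C-(z_{rw}+z_{wo}) & \text{if } z_{wo}+2z_{rw}<C,\\ 0 & \text{otherwise.}\end{cases}$$
   Context: Model. A sender (Alice) communicates with a receiver (Bob) over $C$ parallel directed noiseless links $L_1,\dots,L_C$; in the equal-capacity case each link has unit capacity: over a block of $n$ time slots each link carries a length-$n$ word (one unit of information per time slot; the links are taken in the large-alphabet regime, i.e. symbols may be grouped into elements of finite fields $\mathbb F_{2^b}$ with $b$ growing with $n$). A code of block length $n$ and rate $R$ has message $M$ uniform on $\{0,1\}^{nR}$; the encoder is stochastic, using private randomness of Alice unknown to the adversary, and maps the message and randomness to codewords $\vec X_1,\dots,\vec X_C$ (row $i$ sent on $L_i$). The decoder maps the received words $\vec Y_1,\dots,\vec Y_C$ to an estimate $\hat M$. Adversary. An adversary (Calvin), who knows the encoder and decoder, selects pairwise disjoint link sets $Z_{rw},Z_{ro},Z_{wo}$ (unknown to Alice and Bob) with $|Z_{rw}|\le z_{rw}$, $|Z_{ro}|\le z_{ro}$, $|Z_{wo}|\le z_{wo}$; he can read (eavesdrop) the links in $Z_r=Z_{rw}\cup Z_{ro}$ and write (jam) the links in $Z_w=Z_{rw}\cup Z_{wo}$. Write $z_r=z_{rw}+z_{ro}$,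 $z_w=z_{rw}+z_{wo}$, $\vec z=(z_{rw},z_{ro},z_{wo})$. The adversary is causal: at each time $t$ his jamming of the $t$-th symbols of links in $Z_w$ may depend only on the first $t$ symbols observed on the links in $Z_r$ (and his own randomness). Under additive jamming, the received word on link $i$ is $\vec Y_i=\vec X_i+\vec E_i$ where $\vec E_i$ is chosen by Calvin and $\vec E_i=0$ for $i\notin Z_w$. Under overwrite jamming, $\vec Y_i=\vec E_i$ for $i\in Z_w$ (Calvin replaces the symbols by his own) and $\vec Y_i=\vec X_i$ otherwise. Reliability and capacity. Rate $R$ is achievable if for every $\varepsilon>0$ and all sufficiently large $n$ there is a code of block length $n$ and rate $R$ with $\Pr[\hat M\neq M]<\varepsilon$ against every admissible causal adversary strategy; the capacity is the supremum of achievable rates. (Without feedback, the encoder's output depends only on the message and Alice's randomness.) *)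

(* Defs.v *)
From Stdlib Require Import Reals.
From mathcomp Require Import ssreflect ssrfun ssrbool eqtype ssrnat seq choice.
From mathcomp Require Import fintype finfun bigop finset.

Set Implicit Arguments.
Unset Strict Implicit.
Unset Printing Implicit Defensive.

(* One block of transmissions: link i (in 'I_C) at time slot t (in 'I_n)
   carries one bit (unit capacity = 1 bit per time slot per link). *)
Definition word (C n : nat) := {ffun 'I_C * 'I_n -> bool}.

Definition msg (k : nat) := {ffun 'I_k -> bool}.

Definition nbits (n : nat) (R : R) : nat := Z.to_nat (Int_part (INR n * R)).

Definition Rsum (T : finType) (f : T -> R) : R := \big[Rplus/0%R]_(x : T) f x.

Definition is_distr (T : finType) (p : T -> R) : Prop :=
  (forall x, (0 <= p x)%R) /\ Rsum p = 1%R.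

(* Additive jamming over GF(2): received word = sent word + error word. *)
Definition addw (C n : nat) (x e : word C n) : word C n :=
  [ffun p => xorb (x p) (e p)].

Definition admissible_sets (C zrw zro zwo : nat) (Zrw Zro Zwo : {set 'I_C}) : Prop :=
  [disjoint Zrw & Zro] /\ [disjoint Zrw & Zwo] /\ [disjoint Zro & Zwo] /\
  (#|Zrw| <= zrw)%N /\ (#|Zro| <= zro)%N /\ (#|Zwo| <= zwo)%N.

(* A deterministic causal additive jamming strategy (for a fixed value of the
   adversary's private randomness): maps the transmitted word to an error word,
   which vanishes outside the write set Zw, and whose value at time t depends
   only on the symbols of the read set Zr at times 0..t. *)
Definition causal_jammer (C n : nat) (Zr Zw : {set 'I_C})
    (E : word C n -> word C n) : Prop :=
  (forall (x : word C n) (i : 'I_C) (t : 'I_n), i \notin Zw -> E x (i, t) = false) /\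
  (forall (x x' : word C n) (i : 'I_C) (t : 'I_n),
      (forall (j : 'I_C) (s : 'I_n), j \in Zr -> (s <= t)%N -> x (j, s) = x' (j, s)) ->
      E x (i, t) = E x' (i, t)).

(* Probability of decoding error, message uniform on k bits, stochastic encoder
   enc (a conditional distribution of codewords given the message), decoder dec,
   deterministic jamming strategy E. *)
Definition perr (C n k : nat) (enc : msg k -> word C n -> R) (dec : word C n -> msg k)
    (E : word C n -> word C n) : R :=
  (/ INR (2 ^ k) *
   Rsum (fun m : msg k =>
     Rsum (fun x : word C n =>
       enc m x * (if dec (addw x (E x)) == m then 0 else 1))))%R.

(* Rate R is achievable against every causal additive adversary of
   type (zrw, zro, zwo), without feedback.  A randomized adversary is a
   probability distribution mu over deterministic causal strategies
   (independent of Alice's randomness). *)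
Definition achievable (C zrw zro zwo : nat) (rate : R) : Prop :=
  forall eps : R, (0 < eps)%R ->
  exists N : nat, forall n : nat, (N <= n)%N ->
  exists (enc : msg (nbits n rate) -> word C n -> R) (dec : word C n -> msg (nbits n rate)),
    (forall m, is_distr (enc m)) /\
    forall Zrw Zro Zwo : {set 'I_C}, admissible_sets zrw zro zwo Zrw Zro Zwo ->
    forall mu : {ffun word C n -> word C n} -> R,
      is_distr mu ->
      (forall E, mu E <> 0%R -> causal_jammer (Zrw :|: Zro) (Zrw :|: Zwo) E) ->
      (Rsum (fun E => mu E * perr enc dec E) < eps)%R.

Definition Radd_j (C zrw zro zwo : nat) : R :=
  if (zwo + 2 * zrw < C)%N then INR (C - (zrw + zwo)) else 0%R.

(* Main.v *)
Require Import Defs.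
From Stdlib Require Import Reals Lra ZArith.
From mathcomp Require Import ssreflect ssrfun ssrbool eqtype ssrnat seq choice.
From mathcomp Require Import fintype finfun bigop finset.
From mathcomp Require Import div tuple binomial zify Rstruct.

Set Implicit Arguments.
Unset Strict Implicit.
Unset Printing Implicit Defensive.

(* Converse.  Uniform noise on the writable links leaves only the other
   C - z_w links informative.  If C <= z_wo + 2 z_rw, the jammer erases z_wo
   links by noise and overwrites half of the others by the codeword of an
   independent fake message; swapping the halves and the two messages does not
   change the law of the received word, so Bob cannot tell the true message
   from the fake one.

   Achievability, for K = C - z_w > z_rw.  The n slots split into a head and a
   short tail.  The heads on the links form a code of which any K links
   determine the message.  The tail of each link carries a fresh random key r
   and the tag g_m(r), where distinct messages m, m' and any offset (e, f)
   satisfy g_m'(r + e) = g_m(r) + f for few keys r only.  Bob accepts a message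
   when at least K links have the right head and a valid tail.  The heads
   received do not depend on the keys, by causality, so few wrong messages are
   candidates; at least one of the K > z_rw vouching links is not read-write,
   and there the error added to the tail is independent of the key, so the tag
   check fails with high probability.  Both codes exist by a greedy
   (Gilbert-Varshamov) selection. *)

(** * Existence of the codes *)

Lemma card_exists_le (T I : finType) (Q : pred I) (P : I -> pred T) :
  #|[set x | [exists i in Q, P i x]]| <= \sum_(i in Q) #|[set x | P i x]|.
Proof.
rewrite -sum1_card [X in _ <= X](eq_bigr (fun i =>
  \sum_x if x \in [set x | P i x] then 1 else 0)) => [|i _]; last first.
  by rewrite -sum1_card big_mkcond.
rewrite exchange_big /= [X in X <= _]big_mkcond leq_sum // => x _.
case: ifP => //; rewrite inE => /exists_inP[i iQ Px].
by rewrite (bigD1 i) //= inE Px.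
Qed.

(** Each chosen element forbids at most [D] elements, so while fewer than [#|I|] are chosen the
    forbidden set misses some element of [T]. *)
Lemma greedy (I T : finType) (bad : rel T) D :
  symmetric bad -> (forall x, #|[set y | bad x y]| <= D) ->
  #|I| * D < #|T| ->
  exists f : I -> T, forall i j, i != j -> ~~ bad (f i) (f j).
Proof.
move=> bsym badD ltIT.
have [s [ss ps]] : exists s : seq T,
    size s = #|I| /\ pairwise (fun x y => ~~ bad x y) s.
  have: #|I| <= #|I| by [].
  elim: {1 3}#|I| => [|m IH] ltm; first by exists [::].
  have [s [ss ps]] := IH (ltnW ltm).
  have lecov : #|[set y | [exists i : 'I_(size s), bad (tnth (in_tuple s) i) y]]| < #|T|.
    apply: leq_ltn_trans ltIT.
    apply: (leq_trans (card_exists_le predT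
      (fun i : 'I_(size s) => bad (tnth (in_tuple s) i)))).
    apply: (@leq_trans (\sum_(i < size s) D)); first by apply: leq_sum.
    by rewrite sum_nat_const card_ord ss leq_mul2r ltnW ?orbT.
  set S := [set y | _] in lecov.
  have /card_gt0P[y] : 0 < #|~: S| by move: (cardsC S) lecov; lia.
  rewrite !inE negb_exists => /forallP ny.
  exists (rcons s y); rewrite size_rcons ss pairwise_rcons ps andbT; split=> //.
  apply/allP => x xs.
  have ix : index x s < size s by rewrite index_mem.
  by have := ny (Ordinal ix); rewrite (tnth_nth x) /= nth_index.
(* The strict bound makes [T] inhabited even for empty [I]; this supplies the default of [nth]. *)
have [x0 _] : exists x0 : T, True.
  have : 0 < #|T| by apply: leq_ltn_trans ltIT.
  by move/card_gt0P => [x0 _]; exists x0.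
exists (fun i => nth x0 s (enum_rank i)) => i j nij.
have lts (u : I) : (enum_rank u : nat) \in gtn (size s) by rewrite inE ss ltn_ord.
have /(pairwiseP x0) H := ps.
have [lt_ij|lt_ji|eq_ij] := ltngtP (enum_rank i) (enum_rank j).
- exact: H.
- by rewrite bsym; apply: H.
- by case/eqP: nij; apply/enum_rank_inj/val_inj.
Qed.

Lemma card_agree_on (U B : finType) (D : {set U}) (h : U -> B) :
  #|[set g : {ffun U -> B} | [forall u in D, g u == h u]]| = #|B| ^ (#|U| - #|D|).
Proof.
pose F (u : U) : {pred B} := if u \in D then pred1 (h u) else predT.
transitivity #|family F|.
  rewrite cardsE; apply: eq_card => g; rewrite unfold_in /= [in RHS]unfold_in /=.
  apply: eq_forallb => u; rewrite /F; by case: (u \in D).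
rewrite card_family foldrE big_map big_enum /=.
rewrite (bigID (mem D)) /= big1 ?mul1n => [|u uD]; last by rewrite /F uD card1.
rewrite (eq_bigr (fun=> #|B|)) => [|u uD]; last by rewrite /F (negbTE uD).
rewrite prod_nat_const; congr (_ ^ _).
by rewrite -(cardC D) addKn; apply: eq_card => u; rewrite !inE.
Qed.

(** Union bound over the [t]-element sets [D] of positions where [g] and [h] agree. *)
Lemma card_agree_many (U B : finType) (h : U -> B) t :
  #|[set g : {ffun U -> B} | t <= #|[set u | g u == h u]|]|
    <= 'C(#|U|, t) * #|B| ^ (#|U| - t).
Proof.
apply: leq_trans (_ : #|[set g : {ffun U -> B} |
   [exists D in [set D : {set U} | #|D| == t], [forall u in D, g u == h u]]]| <= _).
  apply/subset_leq_card/subsetP => g; rewrite !inE => /card_geqP[s [us ss sA]].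
  apply/exists_inP; exists [set u in s].
    by rewrite inE cardsE; move/card_uniqP: us => ->; rewrite ss.
  by apply/forall_inP => u; rewrite inE => /sA; rewrite inE.
apply: leq_trans (card_exists_le _ _) _.
rewrite (eq_bigr (fun=> #|B| ^ (#|U| - t))) => [|D]; last first.
  by rewrite inE => /eqP <-; rewrite card_agree_on.
by rewrite sum_nat_const card_draws.
Qed.

Lemma bin_le_exp n m : 'C(n, m) <= n ^ m.
Proof.
rewrite -(leq_pmul2r (fact_gt0 m)) bin_ffact.
apply: (@leq_trans (n ^ m)); last by rewrite leq_pmulr ?fact_gt0.
by elim: m => // m IH; rewrite ffactnSr expnSr leq_mul // leq_subr.
Qed.

Lemma bin_le_pow2 n m : 'C(n, m) <= 2 ^ n.
Proof.
rewrite -{1}(card_ord n) -card_draws (leq_trans (max_card _)) //.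
by rewrite -cardsT -powersetT card_powerset cardsT card_ord.
Qed.

Definition xorw (U : finType) (x e : {ffun U -> bool}) : {ffun U -> bool} :=
  [ffun u => xorb (x u) (e u)].

Lemma xorwK (U : finType) (e : {ffun U -> bool}) : involutive (fun x => xorw x e).
Proof. by move=> x; apply/ffunP => u; rewrite !ffunE; case: (x u); case: (e u). Qed.

(** Words conflict when they agree on at least [K] links; the hypothesis is the Gilbert-Varshamov
    volume bound. *)
Lemma head_code (I B : finType) C K :
  #|I| * ('C(C, K) * #|B| ^ (C - K)) < #|B| ^ C ->
  exists H : I -> {ffun 'I_C -> B}, forall m m', m != m' ->
    #|[set i | H m i == H m' i]| < K.
Proof.
move=> ltIB.
pose bad (x y : {ffun 'I_C -> B}) := K <= #|[set i | y i == x i]|.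
have [|||f Hf] := @greedy I {ffun 'I_C -> B} bad ('C(C, K) * #|B| ^ (C - K)).
- by move=> x y; rewrite /bad; congr (_ <= #|pred_of_set _|);
    apply/setP => i; rewrite !inE eq_sym.
- by move=> x; have := card_agree_many x K; rewrite card_ord.
- by rewrite card_ffun card_ord.
by exists f => m m' nmm; rewrite ltnNge; apply: Hf; rewrite eq_sym.
Qed.

(** Two functions conflict if, for some offset pair, one meets a shifted copy of the other at [t]
    keys or more; the union over offsets gives the factor [2 ^ (a + b)]. Translating the keys by [e]
    exchanges the two roles, so conflict is symmetric. *)
Lemma tag_code (I : finType) a b t :
  #|I| * (2 ^ (a + b) * ('C(2 ^ a, t) * (2 ^ b) ^ (2 ^ a - t))) < (2 ^ b) ^ (2 ^ a) ->
  exists g : I -> {ffun msg a -> msg b}, forall m m', m != m' ->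
    forall e f, #|[set r | g m' (xorw r e) == xorw (g m r) f]| < t.
Proof.
move=> ltI.
pose bad (x y : {ffun msg a -> msg b}) :=
  [exists ef : msg a * msg b, t <= #|[set r | y r == xorw (x (xorw r ef.1)) ef.2]|].
have badS x y : bad x y -> bad y x.
  case/existsP => -[e f] /= H; apply/existsP; exists (e, f) => /=.
  rewrite -(card_imset _ (inv_inj (xorwK e))).
  apply: (leq_trans H); apply/subset_leq_card/subsetP => r; rewrite inE => /eqP Er.
  by apply/imsetP; exists (xorw r e); rewrite ?inE xorwK // Er xorwK.
have [|||g Hg] := @greedy I {ffun msg a -> msg b} bad
   (2 ^ (a + b) * ('C(2 ^ a, t) * (2 ^ b) ^ (2 ^ a - t))).
- by move=> x y; apply/idP/idP; apply: badS.
- move=> x; pose P ef (y : {ffun msg a -> msg b}) :=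
    t <= #|[set r | y r == xorw (x (xorw r ef.1)) ef.2]|.
  apply: leq_trans (card_exists_le predT P : #|[set y | bad x y]| <= _) _.
  apply: (@leq_trans (\sum_(ef : msg a * msg b)
      'C(2 ^ a, t) * (2 ^ b) ^ (2 ^ a - t))).
    apply: leq_sum => ef _.
    have := card_agree_many (fun r => xorw (x (xorw r ef.1)) ef.2) t.
    by rewrite !card_ffun !card_ord !card_bool.
  by rewrite sum_nat_const card_prod !card_ffun !card_ord !card_bool expnD.
- by rewrite !card_ffun !card_ord !card_bool.
exists g => m m' nmm e f; rewrite ltnNge; apply/negP => H.
have /negP := Hg _ _ nmm; apply; apply/existsP; exists (e, f) => /=.
(* [bad] shifts the key of the first function, the claim that of the second; a translation by [e]
   matches them. *)
rewrite -(card_imset _ (inv_inj (xorwK e))) in H.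
apply: (leq_trans H); apply/subset_leq_card/subsetP => _ /imsetP[r + ->].
by rewrite !inE xorwK.
Qed.

(** * Counting the keys that lead to an error *)

Definition upd (I A : finType) (r : {ffun I -> A}) (i : I) (k : A) : {ffun I -> A} :=
  [ffun j => if j == i then k else r j].

Lemma card_fibers (I A : finType) (P : pred {ffun I -> A}) i T :
  (forall r, #|[set k | P (upd r i k)]| <= T) ->
  #|[set r | P r]| * #|A| <= T * #|A| ^ #|I|.
Proof.
(* Exchanging coordinate [i] of [r] with an extra key is an involution. *)
move=> HT; pose sw (q : {ffun I -> A} * A) := (upd q.1 i q.2, q.1 i).
have swK : involutive sw.
  case=> r k; congr (_, _); last by rewrite /= ffunE eqxx.
  by apply/ffunP => j; rewrite !ffunE /=; case: eqP => // ->.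
have -> : #|[set r | P r]| * #|A| = \sum_(q : {ffun I -> A} * A) P (sw q).1.
  rewrite (reindex_inj (inv_inj swK)).
  rewrite (eq_bigr (fun q : {ffun I -> A} * A => nat_of_bool (P q.1))) => [|q _]; last first.
    by rewrite swK.
  rewrite -(pair_bigA _ (fun r _ => nat_of_bool (P r))) /=.
  rewrite -(sum1_card (mem [set r | P r])) big_distrl /=.
  rewrite big_mkcond; apply: eq_bigr => r _.
  by rewrite inE sum_nat_const; case: (P r); rewrite ?mul1n ?muln1 ?muln0.
rewrite -(pair_bigA _ (fun r k => nat_of_bool (P (upd r i k)))) /=.
apply: (@leq_trans (\sum_(r : {ffun I -> A}) T)); last first.
  by rewrite sum_nat_const card_ffun mulnC.
apply: leq_sum => r _; apply: leq_trans (HT r).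
by rewrite -sum1_card [X in _ <= X]big_mkcond leq_sum //= => k _; rewrite inE; case: (P _).
Qed.

(** * Splitting the word on a link into head and tail *)

Definition cat2 a b (u : {ffun 'I_a -> bool}) (w : {ffun 'I_b -> bool}) :
    {ffun 'I_(a + b) -> bool} :=
  [ffun t => match split t with inl i => u i | inr j => w j end].

Definition lpart a b (u : {ffun 'I_(a + b) -> bool}) : {ffun 'I_a -> bool} :=
  [ffun t => u (lshift b t)].

Definition rpart a b (u : {ffun 'I_(a + b) -> bool}) : {ffun 'I_b -> bool} :=
  [ffun t => u (rshift a t)].

Lemma lpart_cat a b u w : lpart (@cat2 a b u w) = u.
Proof. by apply/ffunP => t; rewrite !ffunE (unsplitK (inl _ t)). Qed.

Lemma rpart_cat a b u w : rpart (@cat2 a b u w) = w.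
Proof. by apply/ffunP => t; rewrite !ffunE (unsplitK (inr _ t)). Qed.

Lemma lpart_xor a b u w : @lpart a b (xorw u w) = xorw (lpart u) (lpart w).
Proof. by apply/ffunP => t; rewrite !ffunE. Qed.

Lemma rpart_xor a b u w : @rpart a b (xorw u w) = xorw (rpart u) (rpart w).
Proof. by apply/ffunP => t; rewrite !ffunE. Qed.

Definition link C n (x : word C n) (i : 'I_C) : {ffun 'I_n -> bool} :=
  [ffun t => x (i, t)].

Lemma link_addw C n (x e : word C n) i : link (addw x e) i = xorw (link x i) (link e i).
Proof. by apply/ffunP => t; rewrite !ffunE. Qed.

Lemma link_jammer_off C n Zr Zw (E : word C n -> word C n) x i :
  causal_jammer Zr Zw E -> i \notin Zw -> link (addw x (E x)) i = link x i.
Proof.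
case=> E0 _ iZ; rewrite link_addw; apply/ffunP => t.
by rewrite !ffunE E0 //; case: (x _).
Qed.

(** * Encoder, decoder and the count of bad key tuples *)

Section Scheme.
Variables (C L tau k : nat) (A : finType).
Variables (H : msg k -> {ffun 'I_C -> {ffun 'I_L -> bool}}).
Variables (v : msg k -> A -> {ffun 'I_tau -> bool}) (K T : nat).
Hypothesis H_dist : forall m m', m != m' -> #|[set i | H m i == H m' i]| < K.
(** Algebraic manipulation detection: an error chosen without knowledge of the key rarely turns a
    tail of one message into a valid tail of another. *)
Hypothesis v_amd : forall m m', m != m' -> forall d,
  #|[set r | [exists r', v m' r' == xorw (v m r) d]]| <= T.

Definition codeword m (r : {ffun 'I_C -> A}) : word C (L + tau) :=
  [ffun p => cat2 (H m p.1) (v m (r p.1)) p.2].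

Definition vouches (y : word C (L + tau)) m i :=
  (lpart (link y i) == H m i) && [exists r, rpart (link y i) == v m r].

Definition accepts y m := K <= #|[set i | vouches y m i]|.

(** Any accepted message may be returned: the sent one is accepted under the attacks below, so a
    wrong output needs an accepted wrong message. *)
Definition decode y : msg k := odflt [ffun=> false] [pick m | accepts y m].

Lemma link_codeword m r i : link (codeword m r) i = cat2 (H m i) (v m (r i)).
Proof. by apply/ffunP => t; rewrite !ffunE. Qed.

(** A candidate is determined by the set of links where it agrees with [h]: two candidates sharing
    that set would agree with each other on at least [K] links, against [H_dist]. There are [2 ^ C]
    sets of links. *)
Lemma candidates_card (h : 'I_C -> {ffun 'I_L -> bool}) :
  #|[set m | K <= #|[set i | h i == H m i]|]| <= 2 ^ C.
Proof.
have -> : 2 ^ C = #|powerset [set: 'I_C]| by rewrite card_powerset cardsT card_ord.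
rewrite -(card_in_imset (f := fun m => [set i | h i == H m i])).
  by apply/subset_leq_card/subsetP => S _; rewrite inE subsetT.
move=> m m'; rewrite inE => Km _ /setP eqS; apply/eqP/negPn/negP => nmm.
have := leq_trans (H_dist nmm) Km; rewrite ltnNge => /negP; apply.
apply/subset_leq_card/subsetP => i; rewrite inE => hi.
have := eqS i; rewrite !inE hi => /esym/eqP hi'.
by rewrite -(eqP hi) -hi'.
Qed.

Section Attack.
Variables (Zrw Zro Zwo : {set 'I_C}) (E : word C (L + tau) -> word C (L + tau)).
Hypothesis Edisj : [disjoint Zrw & Zwo] /\ [disjoint Zro & Zwo].
Hypothesis Ecausal : causal_jammer (Zrw :|: Zro) (Zrw :|: Zwo) E.
Hypothesis K_gt : #|Zrw| < K.
Hypothesis K_le : K + #|Zrw :|: Zwo| <= C.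
Variable m : msg k.

Let y r := addw (codeword m r) (E (codeword m r)).

Lemma accepts_sent r : accepts (y r) m.
Proof.
have leK : K <= #|~: (Zrw :|: Zwo)|.
  by have := cardsC (Zrw :|: Zwo); rewrite card_ord; lia.
apply: (leq_trans leK); apply/subset_leq_card/subsetP => i; rewrite !inE => iZ.
rewrite /vouches /y (link_jammer_off _ Ecausal) ?inE // link_codeword.
by rewrite lpart_cat rpart_cat eqxx; apply/existsP; exists (r i).
Qed.

(* Causality: during the head slots the jammer has seen nothing of the keys. *)
Lemma head_const r r' i : lpart (link (y r) i) = lpart (link (y r') i).
Proof.
rewrite /y !link_addw !lpart_xor !link_codeword !lpart_cat; congr xorw.
apply/ffunP => t; rewrite !ffunE; apply: (proj2 Ecausal) => j s _ /= le_st.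
have ltsL : s < L by apply: leq_ltn_trans le_st (ltn_ord t).
have -> : s = lshift tau (Ordinal ltsL) by apply/val_inj.
by rewrite !ffunE /= (unsplitK (inl _ _)).
Qed.

(** Outside [Zrw] no link is both read and written, so with the other keys fixed the error on link
    [i] cannot depend on its own key. *)
Lemma tail_upd i : i \notin Zrw -> forall r, exists d, forall a,
  rpart (link (y (upd r i a)) i) = xorw (v m a) d.
Proof.
move=> iZrw r; exists (rpart (link (E (codeword m r)) i)) => a.
rewrite /y link_addw rpart_xor link_codeword rpart_cat ffunE eqxx; congr xorw.
apply/ffunP => t; rewrite !ffunE.
have [iZwo|iZwo] := boolP (i \in Zwo); last first.
  by rewrite !(proj1 Ecausal) // !inE negb_or iZrw.
(* The new key changes only link [i], which is written here and hence not read. *)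
apply: (proj2 Ecausal) => j s jZr _; rewrite !ffunE /=.
case: eqP => // ji; move: jZr; rewrite ji inE (negbTE iZrw) /= => iZro.
by have /pred0P/(_ i) := proj2 Edisj; rewrite /= iZro iZwo.
Qed.

(** Union bound over pairs of a candidate message and a vouching link outside [Zrw]. There are at
    most [2 ^ C * C] pairs, and varying the key of that link alone shows that each pair accounts for
    at most a fraction [T / #|A|] of the key tuples. *)
Lemma error_card :
  #|[set r | decode (y r) != m]| * #|A| <= 2 ^ C * C * T * #|A| ^ C.
Proof.
pose h r i := lpart (link (y r) i).
(* The heads do not depend on the keys, so any single tuple [r0] serves to define the candidates. *)
have [->|[r0 _]] := set_0Vmem [set r | decode (y r) != m]; first by rewrite cards0.
pose cand := [set m' | (m' != m) && (K <= #|[set i | h r0 i == H m' i]|)].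
pose Q := [set q : msg k * 'I_C | (q.1 \in cand) && (q.2 \notin Zrw)].
pose P (q : msg k * 'I_C) r := [exists a, rpart (link (y r) q.2) == v q.1 a].
have sub : [set r | decode (y r) != m] \subset [set r | [exists q in Q, P q r]].
  apply/subsetP => r; rewrite inE /decode; case: pickP => [m' /= acc nm|]; last first.
    by move/(_ m); rewrite accepts_sent.
  (* At least [K] links vouch for [m'], and [Zrw] has fewer than [K]. *)
  rewrite inE; have [i] : exists i, i \in [set i | vouches (y r) m' i] :\: Zrw.
    apply/card_gt0P; rewrite cardsD subn_gt0; apply: leq_trans acc.
    by apply: leq_ltn_trans K_gt; apply/subset_leq_card/subsetIr.
  rewrite !inE => /andP[iZ /andP[hi ti]]; apply/exists_inP; exists (m', i) => //.
  rewrite !inE nm iZ andbT /=; apply: (leq_trans acc).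
  apply/subset_leq_card/subsetP => j; rewrite !inE => /andP[/eqP <- _].
  by rewrite /h (head_const r r0).
have cardQ : #|Q| <= 2 ^ C * C.
  apply: (@leq_trans #|setX cand [set: 'I_C]|).
    by apply/subset_leq_card/subsetP => q; rewrite !inE => /andP[-> _].
  rewrite cardsX cardsT card_ord leq_mul2r; apply/orP; right.
  apply: leq_trans (candidates_card (h r0)); apply/subset_leq_card/subsetP => m'.
  by rewrite !inE => /andP[].
apply: leq_trans (leq_mul (subset_leq_card sub) (leqnn _)) _.
apply: leq_trans (leq_mul (card_exists_le (mem Q) P) (leqnn _)) _.
rewrite big_distrl /=.
apply: leq_trans (_ : \sum_(q in Q) T * #|A| ^ C <= _); last first.
  by rewrite sum_nat_const mulnA !leq_mul.
apply: leq_sum => -[m' i]; rewrite !inE /= => /andP[/andP[nm _] iZ].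
have := card_fibers (T := T) (i := i) (P := P (m', i)); rewrite card_ord; apply => r.
have [d Hd] := tail_upd iZ r.
have nm' : m != m' by rewrite eq_sym.
apply: leq_trans (v_amd nm' d); apply/subset_leq_card/subsetP => a; rewrite !inE /P /= Hd.
by case/existsP => a' Ha; apply/existsP; exists a'; rewrite eq_sym.
Qed.
End Attack.
End Scheme.

(** * Finite probability *)

Lemma Rsum_ge0 (T : finType) (f : T -> R) :
  (forall x, (0 <= f x)%R) -> (0 <= Rsum f)%R.
Proof. by move=> f0; rewrite /Rsum; elim/big_ind: _ => *; auto; lra. Qed.

Lemma Rsum_le (T : finType) (f g : T -> R) :
  (forall x, (f x <= g x)%R) -> (Rsum f <= Rsum g)%R.
Proof. by move=> fg; rewrite /Rsum; elim/big_ind2: _ => *; auto; lra. Qed.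

Lemma Rsum_ext (T : finType) (f g : T -> R) : f =1 g -> Rsum f = Rsum g.
Proof. by move=> fg; apply: eq_bigr => x _; apply: fg. Qed.

Lemma Rsum_mull (T : finType) c (f : T -> R) :
  Rsum (fun x => c * f x)%R = (c * Rsum f)%R.
Proof. by rewrite /Rsum big_distrr. Qed.

Lemma Rsum_mulr (T : finType) c (f : T -> R) :
  Rsum (fun x => f x * c)%R = (Rsum f * c)%R.
Proof. by rewrite /Rsum big_distrl. Qed.

Lemma Rsum_add (T : finType) (f g : T -> R) :
  Rsum (fun x => f x + g x)%R = (Rsum f + Rsum g)%R.
Proof. by rewrite /Rsum big_split. Qed.

Lemma Rsum_exchange (T U : finType) (f : T -> U -> R) :
  Rsum (fun x => Rsum (f x)) = Rsum (fun y => Rsum (fun x => f x y)).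
Proof. by rewrite /Rsum exchange_big. Qed.

Lemma Rsum_pair (T U : finType) (f : T -> U -> R) :
  Rsum (fun x => Rsum (f x)) = Rsum (fun p : T * U => f p.1 p.2).
Proof. by rewrite /Rsum pair_bigA. Qed.

Lemma Rsum_involution (T : finType) (h : T -> T) (f : T -> R) :
  involutive h -> Rsum (fun x => f (h x)) = Rsum f.
Proof. by move=> hK; rewrite /Rsum [RHS](reindex_inj (inv_inj hK)). Qed.

Lemma Rsum_const (T : finType) c : Rsum (fun _ : T => c) = (INR #|T| * c)%R.
Proof.
rewrite /Rsum big_const; elim: #|T| => [|n IH]; first by rewrite /=; lra.
by rewrite iterS IH S_INR; lra.
Qed.

Lemma Rsum_ind (T : finType) (P : pred T) :
  Rsum (fun x => if P x then 1 else 0)%R = INR #|[set x | P x]|.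
Proof.
rewrite -sum1_card big_mkcond /=.
rewrite (big_morph INR plus_INR (erefl : INR 0 = 0%R)).
by apply: eq_bigr => x _; rewrite inE; case: (P x).
Qed.

(** The law of [F o] for [o] drawn from [w]. *)
Definition pushf (O T : finType) (w : O -> R) (F : O -> T) (y : T) : R :=
  Rsum (fun o => if F o == y then w o else 0%R).

Lemma Rsum_pushf (O T : finType) (w : O -> R) (F : O -> T) (g : T -> R) :
  Rsum (fun y => pushf w F y * g y)%R = Rsum (fun o => w o * g (F o))%R.
Proof.
under Rsum_ext => y do rewrite -Rsum_mulr.
rewrite Rsum_exchange; apply: Rsum_ext => o.
rewrite /Rsum (bigD1 (F o)) //= eqxx big1 ?Rplus_0_r // => y.
by rewrite eq_sym => /negbTE ->; rewrite Rmult_0_l.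
Qed.

Lemma pushf_distr (O T : finType) (w : O -> R) (F : O -> T) :
  is_distr w -> is_distr (pushf w F).
Proof.
case=> w0 w1; split=> [y|].
  by apply: Rsum_ge0 => o; case: eqP => _ //; lra.
have := Rsum_pushf w F (fun=> 1%R).
by rewrite !Rsum_mulr w1 !Rmult_1_r.
Qed.

Lemma pushf_supp (O T : finType) (w : O -> R) (F : O -> T) y :
  pushf w F y <> 0%R -> exists o, F o = y.
Proof.
move=> nz; have [/existsP[o /eqP]|/existsPn none] := boolP [exists o, F o == y].
  by exists o.
case: nz.
by rewrite /pushf /Rsum big1 // => o _; rewrite (negbTE (none o)).
Qed.

Lemma INR_card_gt0 (T : finType) (x : T) : (0 < INR #|T|)%R.
Proof. by apply: lt_0_INR; apply/ltP/card_gt0P; exists x. Qed.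

Definition unif (T : finType) (_ : T) : R := (/ INR #|T|)%R.

Lemma unif_distr (T : finType) (x : T) : is_distr (@unif T).
Proof.
have := INR_card_gt0 x; rewrite /unif; split=> [_|].
  by apply/Rlt_le/Rinv_0_lt_compat.
by rewrite Rsum_const Rinv_r //; lra.
Qed.

Lemma prod_distr (T U : finType) (p : T -> R) (q : U -> R) :
  is_distr p -> is_distr q -> is_distr (fun z : T * U => p z.1 * q z.2)%R.
Proof.
move=> [p0 p1] [q0 q1]; split=> [z|]; first exact: Rmult_le_pos.
rewrite -(Rsum_pair (fun x y => p x * q y)%R).
under Rsum_ext => x do rewrite Rsum_mull q1.
by rewrite Rsum_mulr p1 Rmult_1_r.
Qed.

Lemma card_msg k : #|{: msg k}| = 2 ^ k.
Proof. by rewrite card_ffun card_bool card_ord. Qed.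

Definition joint C n k (enc : msg k -> word C n -> R) (p : msg k * word C n) : R :=
  (/ INR (2 ^ k) * enc p.1 p.2)%R.

Lemma joint_distr C n k (enc : msg k -> word C n -> R) :
  (forall m, is_distr (enc m)) -> is_distr (joint enc).
Proof.
have k0 : (0 < INR (2 ^ k))%R by apply: lt_0_INR; apply/ltP; rewrite expn_gt0.
have ik0 := Rinv_0_lt_compat _ k0.
move=> encD; split=> [p|].
  by apply: Rmult_le_pos; [lra | have [H _] := encD p.1; apply: H].
rewrite /joint -(Rsum_pair (fun m x => / INR (2 ^ k) * enc m x)%R).
under Rsum_ext => m do rewrite Rsum_mull (proj2 (encD m)).
by rewrite Rsum_const card_msg; field; lra.
Qed.

Lemma perr_joint C n k (enc : msg k -> word C n -> R) dec E :
  perr enc dec E = Rsum (fun p => joint enc p *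
    (if dec (addw p.2 (E p.2)) == p.1 then 0 else 1))%R.
Proof.
rewrite /perr -Rsum_mull.
under Rsum_ext => m do rewrite -Rsum_mull.
by rewrite Rsum_pair; apply: Rsum_ext => p; rewrite /joint Rmult_assoc.
Qed.

Lemma perr_success C n k (enc : msg k -> word C n -> R) dec E :
  (forall m, is_distr (enc m)) ->
  perr enc dec E = (1 - Rsum (fun p => joint enc p *
    (if dec (addw p.2 (E p.2)) == p.1 then 1 else 0)))%R.
Proof.
move=> encD; have [_ j1] := joint_distr encD; rewrite perr_joint.
have sub_intro a b c : (a + b = c -> a = c - b)%R by lra.
by apply: sub_intro; rewrite -Rsum_add -[RHS]j1; apply: Rsum_ext => p; case: ifP => _; lra.
Qed.

(** * Error bounds for the two attacks *)

Definition splice C n (Z : {set 'I_C}) (x y : word C n) : word C n :=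
  [ffun p => if p.1 \in Z then x p else y p].

Definition word0 C n : word C n := [ffun=> false].

(** The received word [y] determines the noise on [Z]; the bits of [e] elsewhere are discarded and
    hence free. *)
Lemma noise_hit_card C n k (dec : word C n -> msg k) (Z : {set 'I_C}) m x :
  #|[set e | dec (addw x (splice Z e (word0 C n))) == m]|
    <= #|[set y | dec y == m]| * 2 ^ ((C - #|Z|) * n).
Proof.
apply: leq_trans (_ : #|[set e : word C n | [exists y in [set y | dec y == m],
    [forall p in setX Z [set: 'I_n], e p == (addw x y) p]]]| <= _).
  apply/subset_leq_card/subsetP => e; rewrite !inE => dm.
  apply/exists_inP; exists (addw x (splice Z e (word0 C n))); rewrite ?inE //.
  apply/forall_inP => p; rewrite !inE andbT => pZ; rewrite !ffunE pZ.
  by case: (x p); case: (e p).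
apply: leq_trans (card_exists_le _ _) _.
rewrite -sum_nat_const; apply: leq_sum => y _.
by rewrite card_agree_on card_bool card_prod !card_ord cardsX cardsT card_ord mulnBl.
Qed.

(** For each codeword of [m], the chance of a correct output is at most [M] times the size of the
    decoding region of [m], over the number of words. The regions partition the words, so averaging
    over the messages leaves [M / 2 ^ k]. *)
Lemma noise_error C n k (enc : msg k -> word C n -> R) dec (Z : {set 'I_C}) :
  (forall m, is_distr (enc m)) ->
  (1 - INR (2 ^ ((C - #|Z|) * n)) / INR (2 ^ k) <=
  Rsum (fun e : word C n => unif e *
    perr enc dec (fun=> splice Z e (word0 C n))))%R.
Proof.
move=> encD; set M := INR (2 ^ (_ * n)).
have w0 := INR_card_gt0 (word0 C n).
have iw0 := Rinv_0_lt_compat _ w0.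
have k0 : (0 < INR (2 ^ k))%R by apply: lt_0_INR; apply/ltP; rewrite expn_gt0.
have ik0 := Rinv_0_lt_compat _ k0.
have [_ u1] := unif_distr (word0 C n).
under Rsum_ext => e do rewrite perr_success // Rmult_minus_distr_l Rmult_1_r -Rsum_mull.
under Rsum_ext => e do rewrite /Rminus -[(- _)%R]Rmult_1_l -Ropp_mult_distr_r Ropp_mult_distr_l.
rewrite Rsum_add u1 Rsum_mull Rsum_exchange.
have sub_intro a b : (a <= b -> 1 - b <= 1 + - (1) * a)%R by lra.
apply: sub_intro.
pose c m := INR #|[set y | dec y == m]|.
apply: (@Rle_trans _ (Rsum (fun p : msg k * word C n =>
   enc p.1 p.2 * (c p.1 * (M * / INR (2 ^ k) * / INR #|{: word C n}|)))))%R.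
  apply: Rsum_le => -[m x] /=.
  under Rsum_ext => e do rewrite -Rmult_assoc [(unif e * _)%R]Rmult_comm Rmult_assoc.
  rewrite Rsum_mull /joint /= Rsum_mull Rsum_ind.
  have /leP/le_INR := noise_hit_card dec Z m x; rewrite mult_INR -/M -/(c m) => le.
  have e0 : (0 <= enc m x)%R by have [H _] := encD m; apply: H.
  set hits := INR #|_| in le *.
  have -> : (/ INR (2 ^ k) * enc m x * (/ INR #|{: word C n}| * hits) =
   (enc m x * / INR (2 ^ k) * / INR #|{: word C n}|) * hits)%R by ring.
  have -> : (enc m x * (c m * (M * / INR (2 ^ k) * / INR #|{: word C n}|)) =
   (enc m x * / INR (2 ^ k) * / INR #|{: word C n}|) * (c m * M))%R by ring.
  apply: Rmult_le_compat_l => //.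
  by do 2?[apply: Rmult_le_pos => //]; apply: Rlt_le.
rewrite -(Rsum_pair (fun m x => enc m x * (c m * (M * / INR (2 ^ k) * / INR #|{: word C n}|)))%R).
under Rsum_ext => m do rewrite Rsum_mulr (proj2 (encD m)) Rmult_1_l.
rewrite Rsum_mulr.
have -> : Rsum c = INR #|{: word C n}|.
  rewrite /c; under Rsum_ext => m do rewrite -Rsum_ind.
  rewrite Rsum_exchange -[RHS]Rmult_1_r -Rsum_const; apply: Rsum_ext => y.
  by rewrite /Rsum (bigD1 (dec y)) //= eqxx big1 ?Rplus_0_r // => m; rewrite eq_sym => /negbTE ->.
by apply/Req_le; field; split; apply: Rgt_not_eq.
Qed.

Lemma perr_ext C n k (enc : msg k -> word C n -> R) dec E E' :
  E =1 E' -> perr enc dec E = perr enc dec E'.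
Proof. by move=> eqE; rewrite !perr_joint; apply: Rsum_ext => p; rewrite eqE. Qed.

(* The jammer cancels what is sent on [Z] (which he reads) and substitutes [x']. *)
Definition spoof C n (Z W : {set 'I_C}) (x' e x : word C n) : word C n :=
  splice Z (addw x x') (splice W e (word0 C n)).

(** Both sides carry [x'] on [A], [x] on [B] and [addw x e] on [W]; the shifted noise compensates on
    [W] for the exchange of [x] and [x']. *)
Lemma spoof_swap C n (A B W : {set 'I_C}) (x x' e : word C n) :
  [disjoint A & B] -> [disjoint A & W] -> [disjoint B & W] -> A :|: B :|: W = setT ->
  addw x' (spoof B W x (addw (addw e x) x') x') = addw x (spoof A W x' e x).
Proof.
move=> /pred0P dAB /pred0P dAW /pred0P dBW /setP cov; apply/ffunP => -[i t].
rewrite !ffunE /=; have := dAB i; have := dAW i; have := dBW i; have := cov i.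
rewrite !inE /=; case: (i \in A); case: (i \in B); case: (i \in W) => //=;
  by case: (x _); case: (x' _); case: (e _).
Qed.

(** The two attacks are coupled so that the received words coincide while true and fake message are
    exchanged. One output of [dec] equals both messages only if they are equal, an event of
    probability [/ 2 ^ k]. *)
Lemma spoof_error C n k (enc : msg k -> word C n -> R) dec (A B W : {set 'I_C}) :
  (forall m, is_distr (enc m)) ->
  [disjoint A & B] -> [disjoint A & W] -> [disjoint B & W] -> A :|: B :|: W = setT ->
  let err Z := Rsum (fun q : (msg k * word C n) * word C n =>
    joint enc q.1 * unif q.2 * perr enc dec (spoof Z W q.1.2 q.2))%R in
  (1 - / INR (2 ^ k) <= err A + err B)%R.
Proof.
move=> encD dAB dAW dBW cov err.
(* An outcome lists the fake pair, the noise and the true pair, in this order. *)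
pose Om := (((msg k * word C n) * word C n) * (msg k * word C n))%type.
pose w (z : Om) := (joint enc z.1.1 * unif z.1.2 * joint enc z.2)%R.
pose recv Z (z : Om) := addw z.2.2 (spoof Z W z.1.1.2 z.1.2 z.2.2).
have jD := joint_distr encD.
have [w_ge0 w1] : is_distr w.
  exact: prod_distr (prod_distr jD (unif_distr (word0 C n))) jD.
have errE Z : err Z = Rsum (fun z : Om => w z * (if dec (recv Z z) == z.2.1 then 0 else 1))%R.
  rewrite /err; under Rsum_ext => q do rewrite perr_joint -Rsum_mull.
  by rewrite Rsum_pair; apply: Rsum_ext => z; rewrite -Rmult_assoc.
pose sw (z : Om) : Om := ((z.2, addw (addw z.1.2 z.2.2) z.1.1.2), z.1.1).
have swK : involutive sw.
  move=> [[[m' x'] e] [m x]]; congr (_, _, _).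
  by apply/ffunP => p; rewrite !ffunE /=; case: (e p); case: (x p); case: (x' p).
(* The exchange [sw] preserves [w]; after it, an error of the attack on [B] means that the output
   under the attack on [A] misses the fake message. *)
have errB : err B = Rsum (fun z : Om => w z * (if dec (recv A z) == z.1.1.1 then 0 else 1))%R.
  rewrite errE -(Rsum_involution _ swK); apply: Rsum_ext => -[[[m' x'] e] [m x]].
  rewrite /recv /sw /= (@spoof_swap _ _ A) //; congr (_ * _)%R.
  by rewrite /w /unif /=; ring.
rewrite errB errE -Rsum_add.
have same : Rsum (fun z : Om => w z * (if z.2.1 == z.1.1.1 then 1 else 0))%R = (/ INR (2 ^ k))%R.
  rewrite -(Rsum_pair (fun q p => joint enc q.1 * unif q.2 * joint enc p *
    (if p.1 == q.1.1 then 1 else 0))%R).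
  rewrite -[RHS]Rmult_1_l -[in RHS](proj2 (prod_distr jD (unif_distr (word0 C n)))) -Rsum_mulr.
  apply: Rsum_ext => q; under Rsum_ext => p do rewrite Rmult_assoc.
  rewrite Rsum_mull; congr (_ * _)%R.
  rewrite -(Rsum_pair (fun m x => / INR (2 ^ k) * enc m x * (if m == q.1.1 then 1 else 0))%R).
  under Rsum_ext => m do rewrite Rsum_mulr Rsum_mull (proj2 (encD m)) Rmult_1_r.
  rewrite Rsum_mull /Rsum (bigD1 q.1.1) //= eqxx big1 => [|m /negbTE -> //].
  by rewrite Rplus_0_r Rmult_1_r.
have sub_intro a b c : (a <= b + c -> a - c <= b)%R by lra.
rewrite -same; apply: sub_intro; rewrite -Rsum_add -[X in (X <= _)%R]w1.
apply: Rsum_le => z; have := w_ge0 z.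
case: (dec _ =P z.2.1) => [e1|_]; case: (dec _ =P z.1.1.1) => [e2|_];
  case: (z.2.1 =P z.1.1.1) => [_|ne]; try lra.
by case: ne; rewrite -e1.
Qed.

(** * Achievable rates *)

Lemma Rsum_mixture_le (T : finType) (w f : T -> R) c :
  is_distr w -> (forall x, w x <> 0%R -> (f x <= c)%R) ->
  (Rsum (fun x => w x * f x) <= c)%R.
Proof.
move=> [w0 w1] fc; rewrite -[c]Rmult_1_l -w1 -Rsum_mulr; apply: Rsum_le => x.
have [->|wx] := Req_dec (w x) 0; first lra.
by apply: Rmult_le_compat_l => //; apply: fc.
Qed.

(** An attack may be driven by any finite random source; its image law on strategies is the [mu]
    quantified in [achievable]. *)
Lemma randomized_attack C n k (enc : msg k -> word C n -> R) dec Zr Zw eps :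
  (forall mu : {ffun word C n -> word C n} -> R, is_distr mu ->
     (forall E, mu E <> 0%R -> causal_jammer Zr Zw E) ->
     (Rsum (fun E => mu E * perr enc dec E) < eps)%R) ->
  forall (O : finType) (w : O -> R) (F : O -> word C n -> word C n),
  is_distr w -> (forall o, causal_jammer Zr Zw (F o)) ->
  (Rsum (fun o => w o * perr enc dec (F o)) < eps)%R.
Proof.
move=> Hmu O w F wD Fc; pose G o := [ffun x => F o x].
have GE o : G o =1 F o by move=> x; rewrite ffunE.
under Rsum_ext => o do rewrite -(perr_ext _ _ (GE o)).
rewrite -(Rsum_pushf w G (fun E => perr enc dec E)).
apply: Hmu; first exact: pushf_distr.
move=> E /pushf_supp[o <-]; have [c1 c2] := Fc o.
split=> [x i t iZ|x x' i t Hx]; rewrite !GE; [exact: c1 | exact: c2].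
Qed.

Lemma card_ord_itv C a b : a <= b <= C -> #|[set i : 'I_C | a <= i < b]| = b - a.
Proof.
move=> abC; have lt (j : 'I_(b - a)) : a + j < C by have := ltn_ord j; lia.
rewrite (_ : [set i | _] = [set Ordinal (lt j) | j : 'I_(b - a)]).
  by rewrite card_imset ?card_ord // => j j' [] /addnI/val_inj.
apply/setP => i; rewrite inE; apply/idP/imsetP => [/andP[ai ib]|[j _ ->]] /=.
  have ltj : i - a < b - a by lia.
  by exists (Ordinal ltj) => //; apply/val_inj => /=; rewrite subnKC.
by have := ltn_ord j; lia.
Qed.

Lemma nbits_ub n rate : (0 <= rate)%R -> (INR (nbits n rate) <= INR n * rate)%R.
Proof.
move=> r0; have n0 := pos_INR n; have nr0 := Rmult_le_pos _ _ n0 r0.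
have [ub lb] := base_Int_part (INR n * rate).
rewrite /nbits INR_IZR_INZ Z2Nat.id //.
have : (-1 < Int_part (INR n * rate))%Z by apply: lt_IZR; lra.
by lia.
Qed.

Lemma nbits_lb n rate : (INR n * rate - 1 < INR (nbits n rate))%R.
Proof.
have [ub lb] := base_Int_part (INR n * rate).
apply: (@Rlt_le_trans _ (IZR (Int_part (INR n * rate)))); first lra.
by rewrite [INR (nbits _ _)]INR_IZR_INZ /nbits; apply: IZR_le; lia.
Qed.

Lemma Rlt_div_mul a b d : (0 < d -> a / d < b -> a < b * d)%R.
Proof.
move=> d0 ltab; have := Rmult_lt_compat_r _ _ _ d0 ltab.
by rewrite /Rdiv Rmult_assoc Rinv_l; lra.
Qed.

Lemma ltn_INR a b : (INR a < INR b)%R -> a < b.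
Proof. by move/INR_lt/ltP. Qed.

(** * Converse bounds on the rate *)

Lemma noise_causal C n (Zr Zw : {set 'I_C}) (e : word C n) :
  causal_jammer Zr Zw (fun=> splice Zw e (word0 C n)).
Proof. by split=> // x i t /negbTE iZ; rewrite !ffunE /= iZ. Qed.

(** Above the capacity of the clean links, a long block has at least one message bit too many, which
    already forces an error of [1/2] under noise. *)
Lemma achievable_noise_bound C zrw zro zwo rate :
  zrw + zwo <= C -> achievable C zrw zro zwo rate ->
  (rate <= INR (C - (zrw + zwo)))%R.
Proof.
move=> leC ach; apply: Rnot_lt_le => ltr; set K := C - _ in ltr.
have [N HN] := ach (/ 2)%R ltac:(lra).
(* Rounding in [nbits] costs less than one bit, so a surplus of [2] bits leaves at least one. *)
have [M HM] := INR_unbounded (2 / (rate - INR K)).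
pose n := maxn N M.
have [enc [dec [encD Hatt]]] := HN n (leq_maxl _ _).
have bigk : K * n + 1 <= nbits n rate.
  rewrite addn1; apply: ltn_INR; have := nbits_lb n rate; rewrite mult_INR.
  have /leP/le_INR leMn : M <= n := leq_maxr _ _.
  have : (2 < INR n * (rate - INR K))%R; last by lra.
  by apply: Rlt_div_mul; lra.
pose Zrw := [set i : 'I_C | 0 <= i < zrw].
pose Zwo := [set i : 'I_C | zrw <= i < zrw + zwo].
have dis : [disjoint Zrw & Zwo].
  by apply/pred0P => i; rewrite /= !inE; lia.
have adm : admissible_sets zrw zro zwo Zrw set0 Zwo.
  split; first by rewrite disjoint_sym; apply/pred0P => i; rewrite /= inE.
  split=> //; split; first by apply/pred0P => i; rewrite /= inE.
  by rewrite cards0 !card_ord_itv //; lia.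
have cZ : #|Zrw :|: Zwo| = zrw + zwo.
  by rewrite cardsU (disjoint_setI0 dis) cards0 !card_ord_itv //; lia.
have hi : (_ < / 2)%R := randomized_attack (Hatt _ _ _ adm)
  (F := fun e _ => splice (Zrw :|: Zwo) e (word0 C n)) (unif_distr (word0 C n))
  (noise_causal _ _).
have lo := noise_error dec (Zrw :|: Zwo) encD; rewrite cZ -/K in lo.
suff : (INR (2 ^ (K * n)) / INR (2 ^ nbits n rate) <= / 2)%R.
  apply/Rlt_not_le.
  have := Rle_lt_trans _ _ _ lo hi.
  by lra.
have := leq_pexp2l (isT : 0 < 2) bigk; rewrite addn1 expnS.
move=> /leP/le_INR; rewrite mult_INR.
have k0 : (0 < INR (2 ^ nbits n rate))%R by apply: lt_0_INR; apply/ltP; rewrite expn_gt0.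
move=> H; apply: (Rmult_le_reg_r _ _ _ k0).
by rewrite /Rdiv Rmult_assoc Rinv_l; move: H; rewrite /=; lra.
Qed.

Lemma spoof_causal C n (Z W : {set 'I_C}) (x' e : word C n) :
  causal_jammer (Z :|: set0) (Z :|: W) (spoof Z W x' e).
Proof.
split=> [x i t|x y i t Hxy]; rewrite !ffunE /=.
  by rewrite inE negb_or => /andP[/negbTE -> /negbTE ->].
by case: ifP => // iZ; rewrite Hxy // !inE iZ.
Qed.

(** A positive rate gives at least two messages for large [n], so the errors of the two spoofing
    attacks add up to at least [1/2] and cannot both be below [1/4]. *)
Lemma achievable_spoof_bound C zrw zro zwo rate :
  zrw + zwo <= C -> C <= zwo + 2 * zrw -> achievable C zrw zro zwo rate ->
  (rate <= 0)%R.
Proof.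
move=> leC geC ach; apply: Rnot_lt_le => ltr.
have [N HN] := ach (/ 4)%R ltac:(lra).
have [M HM] := INR_unbounded (2 / rate).
pose n := maxn N M.
have [enc [dec [encD Hatt]]] := HN n (leq_maxl _ _).
have k_gt0 : 0 < nbits n rate.
  apply: ltn_INR; have := nbits_lb n rate.
  have /leP/le_INR leMn : M <= n := leq_maxr _ _.
  have : (2 < INR n * rate)%R by apply: Rlt_div_mul; lra.
  by rewrite /=; lra.
pose W := [set i : 'I_C | 0 <= i < zwo].
pose A := [set i : 'I_C | zwo <= i < zwo + zrw].
(* [B] takes all remaining links, at most [zrw] of them because [C <= zwo + 2 * zrw]. *)
pose B := [set i : 'I_C | zwo + zrw <= i < C].
have dAW : [disjoint A & W] by apply/pred0P => i; rewrite /= !inE; lia.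
have dBW : [disjoint B & W] by apply/pred0P => i; rewrite /= !inE; lia.
have dAB : [disjoint A & B] by apply/pred0P => i; rewrite /= !inE; lia.
have cov : A :|: B :|: W = setT.
  by apply/setP => i; rewrite !inE; have := ltn_ord i; lia.
have lt_err (Z : {set 'I_C}) : [disjoint Z & W] -> #|Z| <= zrw ->
    (Rsum (fun q : (msg (nbits n rate) * word C n) * word C n =>
      joint enc q.1 * unif q.2 * perr enc dec (spoof Z W q.1.2 q.2)) < / 4)%R.
  move=> dZW cZ; have adm : admissible_sets zrw zro zwo Z set0 W.
    split; first by rewrite disjoint_sym; apply/pred0P => i; rewrite /= inE.
    split=> //; split; first by apply/pred0P => i; rewrite /= inE.
    by rewrite cards0 cZ card_ord_itv ?subn0 //; lia.
  apply: (randomized_attack (Hatt _ _ _ adm) (F := fun q => spoof Z W q.1.2 q.2)).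
    exact: prod_distr (joint_distr encD) (unif_distr (word0 C n)).
  by move=> q; apply: spoof_causal.
have errA := lt_err A dAW ltac:(rewrite card_ord_itv; lia).
have errB := lt_err B dBW ltac:(rewrite card_ord_itv; lia).
have := spoof_error dec encD dAB dAW dBW cov.
have : (/ INR (2 ^ nbits n rate) <= / 2)%R.
  apply: Rinv_le_contravar; first lra.
  have /leP/le_INR := leq_pexp2l (isT : 0 < 2) k_gt0.
  by rewrite expn1 /=; lra.
move=> h1 h2; have := Rplus_lt_compat _ _ _ _ errA errB; apply/Rle_not_lt.
by apply: Rle_trans h2; lra.
Qed.

(** * Achievability: error and parameters of the scheme *)

Lemma scheme_perr C L tau k (A : finType) (a0 : A)
    (H : msg k -> {ffun 'I_C -> {ffun 'I_L -> bool}})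
    (v : msg k -> A -> {ffun 'I_tau -> bool}) K T (Zrw Zro Zwo : {set 'I_C})
    (E : word C (L + tau) -> word C (L + tau)) :
  (forall m m', m != m' -> #|[set i | H m i == H m' i]| < K) ->
  (forall m m', m != m' -> forall d,
     #|[set r | [exists r', v m' r' == xorw (v m r) d]]| <= T) ->
  [disjoint Zrw & Zwo] -> [disjoint Zro & Zwo] ->
  causal_jammer (Zrw :|: Zro) (Zrw :|: Zwo) E ->
  #|Zrw| < K -> K + #|Zrw :|: Zwo| <= C ->
  (perr (fun m => pushf (@unif {ffun 'I_C -> A}) (codeword H v m)) (decode H v K) E
     <= INR (2 ^ C * C * T) / INR #|A|)%R.
Proof.
move=> Hd vd d1 d2 Ec K1 K2.
have A0 := INR_card_gt0 a0.
have k0 : (0 < INR (2 ^ k))%R by apply: lt_0_INR; apply/ltP; rewrite expn_gt0.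
have ffE : #|{: {ffun 'I_C -> A}}| = #|A| ^ C by rewrite card_ffun card_ord.
have AC0 : (0 < INR (#|A| ^ C))%R.
  by rewrite -ffE; exact: (INR_card_gt0 [ffun=> a0]).
rewrite /perr -card_msg -Rsum_mull; set b := (_ / _)%R.
have uD : is_distr (@unif (msg k)) := unif_distr [ffun=> false].
apply: (Rsum_mixture_le uD) => m _.
rewrite (Rsum_pushf _ _ (fun x => if decode H v K (addw x (E x)) == m then 0 else 1)%R).
rewrite /unif Rsum_mull ffE.
have -> : Rsum (fun r => if decode H v K (addw (codeword H v m r) (E (codeword H v m r))) == m
     then 0 else 1)%R =
   INR #|[set r | decode H v K (addw (codeword H v m r) (E (codeword H v m r))) != m]|.
  by rewrite -Rsum_ind; apply: Rsum_ext => r; case: eqP.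
have /leP/le_INR := error_card Hd vd (conj d1 d2) Ec K1 K2 m.
rewrite 2!mult_INR => le.
apply: (Rmult_le_reg_r _ _ _ AC0); apply: (Rmult_le_reg_r _ _ _ A0).
have -> : (b * INR (#|A| ^ C) * INR #|A| = INR (2 ^ C * C * T) * INR (#|A| ^ C))%R.
  by rewrite /b; field; lra.
by rewrite [X in (X * _)%R]Rmult_comm -Rmult_assoc Rinv_r ?Rmult_1_l //; lra.
Qed.

(** The tail carries the key with its tag, so [d] splits into a key offset, which forces [r'], and a
    tag offset, which leaves the equation counted by [tag_code]. *)
Lemma tagged_amd k a b (g : msg k -> {ffun msg a -> msg b}) T :
  (forall m m', m != m' -> forall e f,
     #|[set r | g m' (xorw r e) == xorw (g m r) f]| < T) ->
  forall m m', m != m' -> forall d,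
  #|[set r | [exists r', cat2 r' (g m' r') == xorw (cat2 r (g m r)) d]]| <= T.
Proof.
move=> Hg m m' nm d; apply/ltnW.
apply: leq_ltn_trans (Hg m m' nm (lpart d) (rpart d)).
apply/subset_leq_card/subsetP => r; rewrite !inE => /existsP[r' /eqP eqd].
have := congr1 (@lpart a b) eqd; rewrite lpart_xor !lpart_cat => <-.
by have := congr1 (@rpart a b) eqd; rewrite rpart_xor !rpart_cat => ->.
Qed.

(** For the heads, [2 ^ C] bounds the binomial. For the tags, each agreement costs [a] bits in the
    binomial and saves the [a.+1] bits of a tag, a net gain of one bit; the greedy condition becomes
    [k + 2 * a + 1 < T], whence the choice of [T]. *)
Lemma scheme_exists C zrw zro zwo L a k (K := C - (zrw + zwo)) (T := k + 2 * a + 2) :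
  zrw < K -> k + C < L * K ->
  exists (enc : msg k -> word C (L + (a + a.+1)) -> R) dec,
    (forall m, is_distr (enc m)) /\
    forall Zrw Zro Zwo, admissible_sets zrw zro zwo Zrw Zro Zwo ->
    forall E, causal_jammer (Zrw :|: Zro) (Zrw :|: Zwo) E ->
    (perr enc dec E <= INR (2 ^ C * C * T) / INR (2 ^ a))%R.
Proof.
move=> ltK ltk.
have [|H Hd] := @head_code (msg k) {ffun 'I_L -> bool} C K.
  rewrite card_msg card_ffun card_bool card_ord -!expnM.
  apply: leq_ltn_trans (_ : 2 ^ k * (2 ^ C * 2 ^ (L * (C - K))) < _).
    by rewrite leq_mul2l leq_mul2r bin_le_pow2 !orbT.
  rewrite -!expnD ltn_exp2l // mulnBr; have : L * K <= L * C by rewrite leq_mul2l; lia.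
  by lia.
have [|g Hg] := @tag_code (msg k) a a.+1 T.
  rewrite card_msg.
  (* If [T] exceeds the number of keys the binomial vanishes; otherwise [2 ^ a - T] is not
     truncated. *)
  have [lt|ge] := ltnP (2 ^ a) T; first by rewrite bin_small // mul0n !muln0 !expn_gt0.
  apply: leq_ltn_trans (_ : 2 ^ k * (2 ^ (a + a.+1) *
    ((2 ^ a) ^ T * (2 ^ a.+1) ^ (2 ^ a - T))) < _).
    by rewrite !leq_mul2l leq_mul2r bin_le_exp !orbT.
  rewrite -!expnM -!expnD ltn_exp2l // mulnBr.
  have : a.+1 * T <= a.+1 * 2 ^ a by rewrite leq_mul2l ge orbT.
  by rewrite /T; lia.
pose v m (r : msg a) := cat2 r (g m r).
exists (fun m => pushf (@unif {ffun 'I_C -> msg a}) (codeword H v m)), (decode H v K).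
split=> [m|Zrw Zro Zwo [d1 [d2 [d3 [c1 [c2 c3]]]]] E Ec].
  by apply: pushf_distr; apply: unif_distr [ffun=> [ffun=> false]].
rewrite -(card_msg a); apply: (@scheme_perr _ _ _ _ _ [ffun=> false] _ _ _ _ Zrw Zro Zwo) => //.
- exact: tagged_amd.
- exact: leq_ltn_trans ltK.
- by have := (leq_card_setU Zrw Zwo).1; move: ltK; rewrite /K; lia.
Qed.

Lemma sqr_le_exp2 a : a.+1 ^ 2 <= 4 * 2 ^ a.
Proof.
case: a => [|[|a]] //; elim: a => // a IH.
by move: IH; rewrite [2 ^ a.+3]expnS -!mulnn; nia.
Qed.

(** This bounds the error by a constant over [n]: [T] is at most linear in [n], while [2 ^ a] is at
    least a quarter of [a.+1 ^ 2], hence at least a fixed multiple of [n ^ 2]. *)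
Lemma error_bound_vanishes C k q a n : 0 < n -> k <= n * C -> a <= n -> n <= q * a.+1 ->
  2 ^ C * C * (k + 2 * a + 2) * n <= 2 ^ C * C * (4 * (C + 4) * q ^ 2) * 2 ^ a.
Proof.
move=> n0 kn an nq; rewrite -!mulnA leq_mul2l; apply/orP; right.
rewrite leq_mul2l; apply/orP; right.
apply: (@leq_trans ((C + 4) * n * n)); first by rewrite leq_mul2r; nia.
apply: (@leq_trans ((C + 4) * (q * a.+1) ^ 2)).
  by rewrite -mulnA leq_mul2l leq_mul // orbT.
have mono x y z w : w <= 4 * z -> x * (y * w) <= 4 * x * y * z.
  move=> le; have -> : 4 * x * y * z = x * y * (4 * z) by lia.
  by rewrite mulnA leq_mul2l le orbT.
by rewrite expnMn (leq_trans (mono _ _ _ _ (sqr_le_exp2 a))) // !mulnA.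
Qed.

Lemma achievable_below C zrw zro zwo rate :
  zwo + 2 * zrw < C -> (0 <= rate < INR (C - (zrw + zwo)))%R ->
  achievable C zrw zro zwo rate.
Proof.
move=> ltC [r0 rK] eps eps0; set K := C - _ in rK.
have K0 := pos_INR K; have C0 := pos_INR C; have d0 : (0 < INR K - rate)%R by lra.
(* With keys of [a = n %/ q] bits, the [2 * a] tail slots cost [2 * a * K] bits, at most half of the
   slack [n * (K - rate)]. The summand [4] makes the tail fit into the block. *)
have [q Hq] := INR_unbounded (4 * INR K / (INR K - rate) + 4).
have q4 : 4 < q.
  apply: ltn_INR; have := Rle_mult_inv_pos (4 * INR K) _ ltac:(lra) d0.
  by rewrite -/(Rdiv _ _) [INR 4]/=; lra.
have qd : (4 * INR K < INR q * (INR K - rate))%R by apply: Rlt_div_mul => //; lra.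
(* The constant loss [C + K], from the binomial and the one further tail slot, stays below a quarter
   of the slack. *)
have [n1 Hn1] := INR_unbounded (4 * (INR C + INR K) / (INR K - rate)).
pose B := 2 ^ C * C * (4 * (C + 4) * q ^ 2).
(* The error will be at most [B / n], hence below [eps]. *)
have [n2 Hn2] := INR_unbounded (INR B / eps).
exists (maxn 2 (maxn n1 n2)) => n; rewrite !geq_max => /and3P[n_ge2 le1 le2].
have n0 : (0 < INR n)%R by apply: lt_0_INR; lia.
pose a := n %/ q; pose L := n - (a + a.+1); pose k := nbits n rate.
have aq : a * q <= n by apply: leq_divM.
have nq : n <= q * a.+1 by rewrite mulnC ltnW // ltn_ceil //; lia.
have an : a <= n by apply: leq_div.
have En : L + (a + a.+1) = n by rewrite subnK //; nia.
have kn : (INR k <= INR n * rate)%R by apply: nbits_ub.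
have ltk : k + C < L * K.
  apply: ltn_INR; rewrite plus_INR mult_INR.
  have -> : INR L = (INR n - 2 * INR a - 1)%R.
    by have := congr1 INR En; rewrite !plus_INR S_INR; lra.
  have nd : (4 * (INR C + INR K) < INR n * (INR K - rate))%R.
    by apply: Rlt_div_mul => //; have /leP/le_INR := le1; lra.
  have a0 := pos_INR a.
  have : (INR a * (4 * INR K) <= INR a * (INR q * (INR K - rate)))%R.
    by apply: Rmult_le_compat_l => //; lra.
  have : (INR a * INR q * (INR K - rate) <= INR n * (INR K - rate))%R.
    apply: Rmult_le_compat_r; first lra.
    by rewrite -mult_INR; apply/le_INR/leP.
  have : (0 < INR K)%R by lra.
  by nra.
(* The threshold [zwo + 2 * zrw < C] enters here: more links vouch than can be both read and
   written. *)
have ltzK : zrw < K by rewrite /K; lia.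
have := @scheme_exists C zrw zro zwo L a k ltzK ltk; rewrite En => -[enc [dec [encD Hatt]]].
exists enc, dec; split=> // Zrw Zro Zwo adm mu muD muc.
apply: Rle_lt_trans (Rsum_mixture_le muD (fun E nz => Hatt _ _ _ adm E (muc E nz))) _.
have a0 : (0 < INR (2 ^ a))%R by apply: lt_0_INR; apply/ltP; rewrite expn_gt0.
apply: (Rmult_lt_reg_r _ _ _ a0); rewrite /Rdiv Rmult_assoc Rinv_l ?Rmult_1_r; last lra.
apply: (Rmult_lt_reg_r _ _ _ n0); rewrite -mult_INR.
have kC : k <= n * C.
  apply/leP/INR_le; rewrite mult_INR; apply: Rle_trans kn _.
  apply: Rmult_le_compat_l; first lra.
  by have /leP/le_INR : K <= C := leq_subr _ _; lra.
have /leP/le_INR := error_bound_vanishes (ltnW n_ge2) kC an nq.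
move=> le; apply: Rle_lt_trans le _.
rewrite mult_INR -/B.
have lt : (INR B < INR n * eps)%R.
  by apply: Rlt_div_mul => //; have /leP/le_INR := le2; lra.
have -> : (eps * INR (2 ^ a) * INR n = (INR n * eps) * INR (2 ^ a))%R by ring.
exact: Rmult_lt_compat_r.
Qed.

(** At rate [0] the empty message is the only one, so no output is wrong. *)
Lemma achievable_zero C zrw zro zwo : achievable C zrw zro zwo 0.
Proof.
move=> eps eps0; exists 0 => n _.
have k0 : nbits n 0 = 0 by rewrite /nbits Rmult_0_r (Int_part_INR 0).
exists (fun _ => pushf (@unif unit) (fun=> word0 C n)), (fun=> [ffun=> false]); split=> [m|].
  exact: pushf_distr (unif_distr tt).
move=> Zrw Zro Zwo _ mu muD _; apply: Rle_lt_trans eps0.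
apply: Rsum_mixture_le => // E _; rewrite perr_joint.
rewrite /Rsum big1 => [|p _]; first lra.
rewrite (_ : _ == p.1) ?Rmult_0_r //; apply/eqP/ffunP => i.
by exfalso; move: (nat_of_ord i) (ltn_ord i) => j; rewrite k0.
Qed.

Theorem theorem1 (C zrw zro zwo : nat) :
  (zrw + zro + zwo <= C)%N ->
  is_lub (achievable C zrw zro zwo) (Radd_j C zrw zro zwo).
Proof.
move=> leC; have leC' : zrw + zwo <= C by lia.
rewrite /Radd_j; case: ifPn => [lt|]; last first.
  rewrite -leqNgt => ge; split=> [rate|b]; first exact: achievable_spoof_bound.
  by apply; apply: achievable_zero.
split=> [rate|b ub]; first exact: achievable_noise_bound.
apply: Rnot_lt_le => ltb; set K := INR _ in ltb.
have K0 : (0 < K)%R by apply: lt_0_INR; lia.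
have b0 : (0 <= b)%R by apply/ub/achievable_zero.
(* The midpoint of [b] and [K] is achievable yet larger than the upper bound [b]. *)
have ach : achievable C zrw zro zwo ((b + K) / 2).
  by apply: achievable_below lt _; rewrite -/K; lra.
by have := ub _ ach; lra.
Qed.
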